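(* (Homotopy Addition Lemma) In the crossed complexes $a\Delta^n$, with top-dimensional generators $\sigma^n\in(a\Delta^n)_n$, faces $\partial_i\sigma^n$ and $u_n=\iota\otimes v_{n-1}\in(a\Delta^n)_1$, the following formulae hold: $$\delta_2\sigma^2=-\partial_1\sigma^2+\partial_2\sigma^2+\partial_0\sigma^2,$$ $$\delta_3\sigma^3=(\partial_3\sigma^3)^{u_3}-\partial_0\sigma^3-\partial_2\sigma^3+\partial_1\sigma^3,$$ and for $n\ge4$ $$\delta_n\sigma^n=(\partial_n\sigma^n)^{u_n}+\sum_{i=0}^{n-1}(-1)^{n-i}\partial_i\sigma^n.$$
   Context: **Crossed complexes.** All groupoid and group compositions are written additively; if $a:p\to q$ and $b:q\to r$ are arrows of a groupoid then $a+b:p\to r$. A crossed complex $C$ consists of a set $C_0$; a groupoid $C_1$ with object set $C_0$ and source and target maps $s,t$; for each $n\ge 2$ a family of groups $C_n(p)$, $p\in C_0$ (for $x\in C_n(p)$ put $sx=tx=p$; also $tv=v$ for $v\in C_0$); a right action of $C_1$ on each $C_n$, $n\ge2$, so that $x\in C_n(p)$ and $a\in C_1(p,q)$ give $x^a\in C_n(q)$ with the usual rules; and families of homomorphisms $\delta_n:C_n(p)\to C_{n-1}(p)$ for $n\ge3$ and $\delta_2:C_2(p)\to C_1(p,p)$, such that: $\delta_{n-1}\delta_n=0$; the $\delta_n$ preserve the actions, where $C_1$ acts on its vertex groups by conjugation, so $\delta_2(x^a)=-a+\delta_2x+a$; $-y+x+y=x^{\delta_2y}$ for $x,y\in C_2(p)$;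 for $n\ge3$, $C_n$ is abelian and $\delta_2C_2$ acts trivially on $C_n$. Morphisms preserve all the structure. **Cylinder.** $\mathcal I$ is (the crossed complex given by) the indiscrete groupoid on two objects $0,1$, with unique arrow $\iota:0\to1$. For a crossed complex $C$, the cylinder $\mathcal I\otimes C$ is the crossed complex generated by elements $0\otimes x$, $1\otimes x$ of dimension $n$ and $\iota\otimes x$ of dimension $n+1$, for all $n\ge0$, $x\in C_n$, subject to the relations: for $e=0,1$ the map $x\mapsto e\otimes x$ is a morphism of crossed complexes $C\to\mathcal I\otimes C$; $t(\iota\otimes x)=1\otimes tx$; $s(\iota\otimes x)=0\otimes x$ for $n=0$; $\iota\otimes(x+y)=(\iota\otimes x)^{1\otimes y}+\iota\otimes y$ for $n=1$; $\iota\otimes(x+y)=\iota\otimes x+\iota\otimes y$ and $\iota\otimes x^c=(\iota\otimes x)^{1\otimes c}$ for $n\ge2$, $c\in C_1$; $\delta_2(\iota\otimes x)=-(1\otimes x)-(\iota\otimes sx)+(0\otimes x)+(\iota\otimes tx)$ for $n=1$; $\delta_{n+1}(\iota\otimes x)=-(\iota\otimes\delta_nx)-(1\otimes x)+(0\otimes x)^{\iota\otimes tx}$ for $n\ge2$. **Cone.** $\mathrm{Cone}(C)$ is the pushout of crossed complexes of $\mathcal I\otimes C\leftarrow\{1\}\otimes C\to\{v\}$, where $\{v\}$ is the trivial crossed complex on one vertex $v$, called the vertex of the cone. Images of $0\otimes x$, $\iota\otimes x$ in the cone are denoted by the same symbols. **Algebraic simplices.** $a\Delta^0$ is the trivial crossed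 complex on a single vertex, and $a\Delta^n=\mathrm{Cone}(a\Delta^{n-1})$ for $n\ge1$; in particular $a\Delta^1=\mathcal I$. The vertices of $a\Delta^n$ are $v_0,\dots,v_n$, where $v_n=v$ is the vertex of the last cone construction and, for $i<n$, $v_i$ is $0\otimes v_i$ with the latter $v_i$ a vertex of $a\Delta^{n-1}$. Define inductively $\sigma^0=v$ (the vertex of $a\Delta^0$), $\sigma^1=\iota$, and $\sigma^n=\iota\otimes\sigma^{n-1}$ for $n\ge2$. The faces of $\sigma^1$ are its end points $\partial_0\sigma^1=v_1=1$ and $\partial_1\sigma^1=v_0=0$; for $n\ge2$, $\partial_i\sigma^n=\iota\otimes\partial_i\sigma^{n-1}$ if $i<n$ and $\partial_n\sigma^n=0\otimes\sigma^{n-1}$. In $u_n=\iota\otimes v_{n-1}$, $v_{n-1}$ is the last vertex of $a\Delta^{n-1}$. *)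

(* Defs.v *)
From mathcomp Require Import all_boot.
From mathcomp Require Import boolp.

Set Implicit Arguments.
Unset Strict Implicit.
Unset Printing Implicit Defensive.

Declare Scope xc_scope.
Delimit Scope xc_scope with xc.

(* All cells of dimension n are collected in one type [cell n]; the group
   C_n(p), n >= 2, is the set of cells x with [src x = tgt x = p], and C_1(p,q)
   is the set of cells a with [src a = p] and [tgt a = q].  The operations are
   total functions, but the laws constrain them only on composable arguments
   ([tgt x = src y] for x + y and [tgt x = src a] for x ^ a); their values on
   other arguments are irrelevant.  Since source and target agree in
   dimension >= 2, there [tgt x = src y] says that x and y lie in the same
   group.  [delta] maps dimension n+2 to dimension n+1. *)
Record xcomplex := XComplex {
  cell :> nat -> Type;
  src : forall n, cell n -> cell 0;
  tgt : forall n, cell n -> cell 0;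
  zero : forall n, cell 0 -> cell n.+1;
  add : forall n, cell n.+1 -> cell n.+1 -> cell n.+1;
  opp : forall n, cell n.+1 -> cell n.+1;
  act : forall n, cell n.+2 -> cell 1 -> cell n.+2;
  delta : forall n, cell n.+2 -> cell n.+1;

  src_obj : forall v : cell 0, src v = v;
  tgt_obj : forall v : cell 0, tgt v = v;
  src_loop : forall n (x : cell n.+2), src x = tgt x;
  src_zero : forall n (p : cell 0), src (zero n p) = p;
  tgt_zero : forall n (p : cell 0), tgt (zero n p) = p;
  src_add : forall n (x y : cell n.+1), tgt x = src y -> src (add x y) = src x;
  tgt_add : forall n (x y : cell n.+1), tgt x = src y -> tgt (add x y) = tgt y;
  src_opp : forall n (x : cell n.+1), src (opp x) = tgt x;
  tgt_opp : forall n (x : cell n.+1), tgt (opp x) = src x;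
  tgt_act : forall n (x : cell n.+2) (a : cell 1),
    tgt x = src a -> tgt (act x a) = tgt a;
  src_delta : forall n (x : cell n.+2), src (delta x) = src x;
  tgt_delta : forall n (x : cell n.+2), tgt (delta x) = tgt x;

  add_assoc : forall n (x y z : cell n.+1), tgt x = src y -> tgt y = src z ->
    add x (add y z) = add (add x y) z;
  add_zero_l : forall n (x : cell n.+1), add (zero n (src x)) x = x;
  add_zero_r : forall n (x : cell n.+1), add x (zero n (tgt x)) = x;
  add_opp_l : forall n (x : cell n.+1), add (opp x) x = zero n (tgt x);
  add_opp_r : forall n (x : cell n.+1), add x (opp x) = zero n (src x);
  add_comm : forall n (x y : cell n.+3), tgt x = src y -> add x y = add y x;

  act_add : forall n (x y : cell n.+2) (a : cell 1),
    tgt x = src y -> tgt y = src a ->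
    act (add x y) a = add (act x a) (act y a);
  act_zero : forall n (x : cell n.+2), act x (zero 0 (tgt x)) = x;
  act_act : forall n (x : cell n.+2) (a b : cell 1),
    tgt x = src a -> tgt a = src b -> act x (add a b) = act (act x a) b;

  delta_add : forall n (x y : cell n.+2), tgt x = src y ->
    delta (add x y) = add (delta x) (delta y);
  delta_delta : forall n (x : cell n.+3), delta (delta x) = zero n (tgt x);
  delta_act1 : forall (x : cell 2) (a : cell 1), tgt x = src a ->
    delta (act x a) = add (add (opp a) (delta x)) a;
  delta_act : forall n (x : cell n.+3) (a : cell 1), tgt x = src a ->
    delta (act x a) = act (delta x) a;
  peiffer : forall x y : cell 2, tgt x = src y ->
    add (add (opp y) x) y = act x (delta y);
  act_delta : forall n (x : cell n.+3) (y : cell 2), tgt x = src y ->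
    act x (delta y) = x }.

Arguments src {_ n} _.
Arguments tgt {_ n} _.
Arguments zero {_ n} _.
Arguments add {_ n} _ _.
Arguments opp {_ n} _.
Arguments act {_ n} _ _.
Arguments delta {_ n} _.

Notation "x + y" := (add x y) : xc_scope.
Notation "- x" := (opp x) : xc_scope.
Notation "x - y" := (add x (opp y)) : xc_scope.
Notation "x ^ a" := (act x a) : xc_scope.

Record is_morph (C D : xcomplex) (f : forall n, C n -> D n) : Prop := IsMorph {
  morph_src : forall n (x : C n), f 0 (src x) = src (f n x);
  morph_tgt : forall n (x : C n), f 0 (tgt x) = tgt (f n x);
  morph_zero : forall n (p : C 0), f n.+1 (zero p) = zero (f 0 p);
  morph_add : forall n (x y : C n.+1), tgt x = src y ->
    f n.+1 (x + y)%xc = (f n.+1 x + f n.+1 y)%xc;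
  morph_opp : forall n (x : C n.+1), f n.+1 (- x)%xc = (- f n.+1 x)%xc;
  morph_act : forall n (x : C n.+2) (a : C 1), tgt x = src a ->
    f n.+2 (x ^ a)%xc = (f n.+2 x ^ f 1 a)%xc;
  morph_delta : forall n (x : C n.+2), f n.+1 (delta x) = delta (f n.+2 x) }.

Record morph (C D : xcomplex) := Morph {
  morph_fun :> forall n, C n -> D n;
  morphP : is_morph morph_fun }.

(* The crossed complex generated by a graded family G subject to relations.
   The relations are given by the predicate M on interpretations of G in
   crossed complexes; M is meant to be a conjunction of (conditional) equations
   in the language of crossed complexes.  Formal expressions in the generators
   are [valid] if the compositions in them are defined in every crossed complex
   in which the relations hold, and two of them are identified if they take the
   same value in every such crossed complex. *)
Section Presentation.

Variable G : nat -> Type.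
Variable M : forall D : xcomplex, (forall n, G n -> D n) -> Prop.

Inductive term : nat -> Type :=
| Gen n of G n : term n
| Src n of term n : term 0
| Tgt n of term n : term 0
| Zero n of term 0 : term n.+1
| Add n of term n.+1 & term n.+1 : term n.+1
| Opp n of term n.+1 : term n.+1
| Act n of term n.+2 & term 1 : term n.+2
| Delta n of term n.+2 : term n.+1.

Fixpoint eval (D : xcomplex) (f : forall n, G n -> D n) n (t : term n) : D n :=
  match t in term n return D n with
  | Gen n g => f n g
  | Src _ x => src (eval f x)
  | Tgt _ x => tgt (eval f x)
  | Zero _ p => zero (eval f p)
  | Add _ x y => add (eval f x) (eval f y)
  | Opp _ x => opp (eval f x)
  | Act _ x a => act (eval f x) (eval f a)
  | Delta _ x => delta (eval f x)
  end.

Fixpoint defined (D : xcomplex) (f : forall n, G n -> D n) n (t : term n) :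
    Prop :=
  match t with
  | Gen _ _ => True
  | Src _ x => defined f x
  | Tgt _ x => defined f x
  | Zero _ p => defined f p
  | Add _ x y =>
      [/\ defined f x, defined f y & tgt (eval f x) = src (eval f y)]
  | Opp _ x => defined f x
  | Act _ x a =>
      [/\ defined f x, defined f a & tgt (eval f x) = src (eval f a)]
  | Delta _ x => defined f x
  end.

Definition valid n (t : term n) : Prop :=
  forall (D : xcomplex) (f : forall n, G n -> D n), M f -> defined f t.

Definition equal_in_models n (t u : term n) : Prop :=
  forall (D : xcomplex) (f : forall n, G n -> D n), M f -> eval f t = eval f u.

Definition pcell n : Type :=
  {P : term n -> Prop | exists2 t, valid t & P = equal_in_models t}.

Definition cls n (t : term n) (ht : valid t) : pcell n :=
  exist _ (equal_in_models t) (ex_intro2 _ _ t ht erefl).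

Definition rep n (c : pcell n) : term n :=
  proj1_sig (cid2 (proj2_sig c)).

Lemma rep_valid n (c : pcell n) : valid (rep c).
Proof. by rewrite /rep; case: cid2. Qed.

Lemma clsK n (c : pcell n) : cls (rep_valid c) = c.
Proof.
case: c (rep_valid c) => P hP; rewrite /rep /=.
case: cid2 => t /= vt eP v; subst P; exact: eq_exist.
Qed.

Lemma cls_eq n (t u : term n) (ht : valid t) (hu : valid u) :
  equal_in_models t u -> cls ht = cls hu.
Proof.
move=> e; apply: eq_exist; apply/funext => w; apply/propext; split.
  by move=> tw D f m; rewrite -(e D f m) (tw D f m).
by move=> uw D f m; rewrite (e D f m) (uw D f m).
Qed.

Lemma rep_cls n (t : term n) (ht : valid t) : equal_in_models (rep (cls ht)) t.
Proof.
rewrite /rep; case: cid2 => u vu /= e D f m.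
by have : equal_in_models t t by []; rewrite e => /(_ D f m).
Qed.

Definition clsd n (t : term n) (c : pcell n) : pcell n :=
  if pselect (valid t) is left ht then cls ht else c.

Definition val (D : xcomplex) (f : forall n, G n -> D n) n (c : pcell n) : D n :=
  eval f (rep c).

Definition psrc n (c : pcell n) : pcell 0 :=
  @cls 0 (Src (rep c)) (@rep_valid n c).
Definition ptgt n (c : pcell n) : pcell 0 :=
  @cls 0 (Tgt (rep c)) (@rep_valid n c).
Definition pzero n (c : pcell 0) : pcell n.+1 :=
  @cls n.+1 (Zero n (rep c)) (@rep_valid 0 c).
Definition padd n (c d : pcell n.+1) : pcell n.+1 :=
  clsd (Add (rep c) (rep d)) c.
Definition popp n (c : pcell n.+1) : pcell n.+1 :=
  @cls n.+1 (Opp (rep c)) (@rep_valid n.+1 c).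
Definition pact n (c : pcell n.+2) (a : pcell 1) : pcell n.+2 :=
  clsd (Act (rep c) (rep a)) c.
Definition pdelta n (c : pcell n.+2) : pcell n.+1 :=
  @cls n.+1 (Delta (rep c)) (@rep_valid n.+2 c).

Lemma pext n (c d : pcell n) :
  (forall (D : xcomplex) (f : forall n, G n -> D n), M f -> val f c = val f d) ->
  c = d.
Proof. by move=> e; rewrite -(clsK c) -(clsK d); apply: cls_eq. Qed.

Section Val.
Variables (D : xcomplex) (f : forall n, G n -> D n) (m : M f).

Lemma val_cls n (t : term n) (ht : valid t) : val f (cls ht) = eval f t.
Proof. exact: rep_cls. Qed.
Lemma val_src n (c : pcell n) : val f (psrc c) = src (val f c).
Proof. exact: rep_cls. Qed.
Lemma val_tgt n (c : pcell n) : val f (ptgt c) = tgt (val f c).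
Proof. exact: rep_cls. Qed.
Lemma val_zero n (c : pcell 0) : val f (pzero n c) = zero (val f c).
Proof. exact: rep_cls. Qed.
Lemma val_opp n (c : pcell n.+1) : val f (popp c) = opp (val f c).
Proof. exact: rep_cls. Qed.
Lemma val_delta n (c : pcell n.+2) : val f (pdelta c) = delta (val f c).
Proof. exact: rep_cls. Qed.
Lemma val_comp k n (c : pcell k) (d : pcell n) :
  ptgt c = psrc d -> tgt (val f c) = src (val f d).
Proof. by move=> e; rewrite -val_tgt e val_src. Qed.

End Val.

Lemma val_add (D : xcomplex) (f : forall n, G n -> D n) n (c d : pcell n.+1) :
  ptgt c = psrc d -> M f -> val f (padd c d) = add (val f c) (val f d).
Proof.
move=> e m; rewrite /padd /clsd; case: pselect => [h|[]]; first exact: rep_cls.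
move=> E g k; split; [exact: rep_valid | exact: rep_valid |].
exact: (val_comp k e).
Qed.

Lemma val_act (D : xcomplex) (f : forall n, G n -> D n) n (c : pcell n.+2)
    (a : pcell 1) :
  ptgt c = psrc a -> M f -> val f (pact c a) = act (val f c) (val f a).
Proof.
move=> e m; rewrite /pact /clsd; case: pselect => [h|[]]; first exact: rep_cls.
move=> E g k; split; [exact: rep_valid | exact: rep_valid |].
exact: (val_comp k e).
Qed.

Lemma psrc_obj (v : pcell 0) : psrc v = v.
Proof. by apply: pext => D f m; rewrite val_src // src_obj. Qed.
Lemma ptgt_obj (v : pcell 0) : ptgt v = v.
Proof. by apply: pext => D f m; rewrite val_tgt // tgt_obj. Qed.
Lemma psrc_loop n (x : pcell n.+2) : psrc x = ptgt x.
Proof. by apply: pext => D f m; rewrite val_src // val_tgt // src_loop. Qed.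
Lemma psrc_zero n (p : pcell 0) : psrc (pzero n p) = p.
Proof. by apply: pext => D f m; rewrite val_src // val_zero // src_zero. Qed.
Lemma ptgt_zero n (p : pcell 0) : ptgt (pzero n p) = p.
Proof. by apply: pext => D f m; rewrite val_tgt // val_zero // tgt_zero. Qed.
Lemma psrc_add n (x y : pcell n.+1) : ptgt x = psrc y -> psrc (padd x y) = psrc x.
Proof.
move=> e; apply: pext => D f m.
by rewrite !val_src // val_add // src_add //; apply: val_comp.
Qed.
Lemma ptgt_add n (x y : pcell n.+1) : ptgt x = psrc y -> ptgt (padd x y) = ptgt y.
Proof.
move=> e; apply: pext => D f m.
by rewrite !val_tgt // val_add // tgt_add //; apply: val_comp.
Qed.
Lemma psrc_opp n (x : pcell n.+1) : psrc (popp x) = ptgt x.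
Proof. by apply: pext => D f m; rewrite val_src // val_tgt // val_opp // src_opp. Qed.
Lemma ptgt_opp n (x : pcell n.+1) : ptgt (popp x) = psrc x.
Proof. by apply: pext => D f m; rewrite val_src // val_tgt // val_opp // tgt_opp. Qed.
Lemma ptgt_act n (x : pcell n.+2) (a : pcell 1) :
  ptgt x = psrc a -> ptgt (pact x a) = ptgt a.
Proof.
move=> e; apply: pext => D f m.
by rewrite !val_tgt // val_act // tgt_act //; apply: val_comp.
Qed.
Lemma psrc_act n (x : pcell n.+2) (a : pcell 1) :
  ptgt x = psrc a -> psrc (pact x a) = ptgt a.
Proof. by rewrite psrc_loop; apply: ptgt_act. Qed.
Lemma psrc_delta n (x : pcell n.+2) : psrc (pdelta x) = psrc x.
Proof. by apply: pext => D f m; rewrite !val_src // val_delta // src_delta. Qed.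
Lemma ptgt_delta n (x : pcell n.+2) : ptgt (pdelta x) = ptgt x.
Proof. by apply: pext => D f m; rewrite !val_tgt // val_delta // tgt_delta. Qed.

Definition pbd := (psrc_obj, ptgt_obj, psrc_zero, ptgt_zero, psrc_add, ptgt_add,
  psrc_opp, ptgt_opp, psrc_act, ptgt_act, psrc_delta, ptgt_delta).
Definition pval := (val_src, val_tgt, val_zero, val_opp, val_delta, val_add,
  val_act).

Lemma padd_assoc n (x y z : pcell n.+1) : ptgt x = psrc y -> ptgt y = psrc z ->
  padd x (padd y z) = padd (padd x y) z.
Proof.
move=> e1 e2; apply: pext => D f m.
by rewrite !pval ?pbd // add_assoc //; apply: val_comp.
Qed.
Lemma padd_zero_l n (x : pcell n.+1) : padd (pzero n (psrc x)) x = x.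
Proof. by apply: pext => D f m; rewrite !pval ?pbd // add_zero_l. Qed.
Lemma padd_zero_r n (x : pcell n.+1) : padd x (pzero n (ptgt x)) = x.
Proof. by apply: pext => D f m; rewrite !pval ?pbd // add_zero_r. Qed.
Lemma padd_opp_l n (x : pcell n.+1) : padd (popp x) x = pzero n (ptgt x).
Proof. by apply: pext => D f m; rewrite !pval ?pbd // add_opp_l. Qed.
Lemma padd_opp_r n (x : pcell n.+1) : padd x (popp x) = pzero n (psrc x).
Proof. by apply: pext => D f m; rewrite !pval ?pbd // add_opp_r. Qed.

Lemma padd_comm n (x y : pcell n.+3) : ptgt x = psrc y -> padd x y = padd y x.
Proof.
move=> e; have e' : ptgt y = psrc x by rewrite -psrc_loop -e psrc_loop.
apply: pext => D f m.
by rewrite !pval // add_comm //; apply: val_comp.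
Qed.

Lemma pact_add n (x y : pcell n.+2) (a : pcell 1) :
  ptgt x = psrc y -> ptgt y = psrc a ->
  pact (padd x y) a = padd (pact x a) (pact y a).
Proof.
move=> e1 e2; have e3 : ptgt x = psrc a by rewrite e1 psrc_loop.
apply: pext => D f m; rewrite !pval ?pbd // act_add //; exact: val_comp.
Qed.

Lemma pact_zero n (x : pcell n.+2) : pact x (pzero 0 (ptgt x)) = x.
Proof. by apply: pext => D f m; rewrite !pval ?pbd // act_zero. Qed.

Lemma pact_act n (x : pcell n.+2) (a b : pcell 1) :
  ptgt x = psrc a -> ptgt a = psrc b -> pact x (padd a b) = pact (pact x a) b.
Proof.
move=> e1 e2; apply: pext => D f m.
rewrite !pval ?pbd // act_act //; exact: val_comp.
Qed.

Lemma pdelta_add n (x y : pcell n.+2) : ptgt x = psrc y ->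
  pdelta (padd x y) = padd (pdelta x) (pdelta y).
Proof.
move=> e; apply: pext => D f m.
rewrite !pval ?pbd // delta_add //; exact: val_comp.
Qed.

Lemma pdelta_delta n (x : pcell n.+3) : pdelta (pdelta x) = pzero n (ptgt x).
Proof. by apply: pext => D f m; rewrite !pval // delta_delta. Qed.

Lemma pdelta_act1 (x : pcell 2) (a : pcell 1) : ptgt x = psrc a ->
  pdelta (pact x a) = padd (padd (popp a) (pdelta x)) a.
Proof.
move=> e; have e' : psrc a = psrc x by rewrite psrc_loop.
have e2 : ptgt (popp a) = psrc (pdelta x) by rewrite !pbd.
apply: pext => D f m.
by rewrite !pval ?pbd // delta_act1 //; apply: val_comp.
Qed.

Lemma pdelta_act n (x : pcell n.+3) (a : pcell 1) : ptgt x = psrc a ->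
  pdelta (pact x a) = pact (pdelta x) a.
Proof.
move=> e; apply: pext => D f m.
rewrite !pval ?pbd // delta_act //; exact: val_comp.
Qed.

Lemma ppeiffer (x y : pcell 2) : ptgt x = psrc y ->
  padd (padd (popp y) x) y = pact x (pdelta y).
Proof.
move=> e; have e' : psrc y = psrc x by rewrite -e psrc_loop.
have e2 : ptgt (popp y) = psrc x by rewrite !pbd.
by apply: pext => D f m; rewrite !pval ?pbd // peiffer //; apply: val_comp.
Qed.

Lemma pact_delta n (x : pcell n.+3) (y : pcell 2) : ptgt x = psrc y ->
  pact x (pdelta y) = x.
Proof.
move=> e; apply: pext => D f m.
by rewrite !pval ?pbd // act_delta //; apply: val_comp.
Qed.

Definition pres : xcomplex :=
  XComplex psrc_obj ptgt_obj psrc_loop psrc_zero ptgt_zero psrc_add ptgt_add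
    psrc_opp ptgt_opp ptgt_act psrc_delta ptgt_delta 
    padd_assoc padd_zero_l padd_zero_r padd_opp_l padd_opp_r padd_comm
    pact_add pact_zero pact_act pdelta_add pdelta_delta pdelta_act1
    pdelta_act ppeiffer pact_delta.

End Presentation.

Section UniversalProperty.

Variable G : nat -> Type.
Variable M : forall D : xcomplex, (forall n, G n -> D n) -> Prop.

Definition pgen n (g : G n) : pres M n :=
  @cls G M n (Gen g) (fun D f m => I).

Lemma val_gen (D : xcomplex) (f : forall n, G n -> D n) n (g : G n) :
  M f -> val f (pgen g) = f n g.
Proof. by move=> m; rewrite val_cls. Qed.

Lemma val_morph (D : xcomplex) (f : forall n, G n -> D n) :
  M f -> @is_morph (pres M) D (@val G M D f).
Proof.
move=> m; split=> *.
- exact: val_src.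
- exact: val_tgt.
- exact: val_zero.
- exact: val_add.
- exact: val_opp.
- exact: val_act.
- exact: val_delta.
Qed.

Lemma morph_cls (D : xcomplex) (f : forall n, G n -> D n)
    (h : forall n, pres M n -> D n) :
  M f -> is_morph h -> (forall n (g : G n), h n (pgen g) = f n g) ->
  forall n (t : term G n) (ht : valid M t), h n (cls ht) = eval f t.
Proof.
move=> m hm hg n t; elim: t => {n} [n g|n x IH|n x IH|n p IH|n x IHx y IHy
  |n x IH|n x IHx a IHa|n x IH] ht /=.
- rewrite -hg; congr h; exact: cls_eq.
- rewrite -(IH ht) -(morph_src hm); congr h.
  by apply: (@pext G M) => E k mk; rewrite (val_src mk) !(val_cls mk).
- rewrite -(IH ht) -(morph_tgt hm); congr h.
  by apply: (@pext G M) => E k mk; rewrite (val_tgt mk) !(val_cls mk).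
- rewrite -(IH ht) -(morph_zero hm); congr h.
  by apply: (@pext G M) => E k mk; rewrite (val_zero mk) !(val_cls mk).
- have vx : valid M x by move=> E k mk; case: (ht E k mk).
  have vy : valid M y by move=> E k mk; case: (ht E k mk).
  have c : ptgt (cls vx) = psrc (cls vy).
    apply: (@pext G M) => E k mk.
    by rewrite (val_tgt mk) (val_src mk) !(val_cls mk); case: (ht E k mk).
  rewrite -(IHx vx) -(IHy vy) -(morph_add hm c); congr h.
  by apply: (@pext G M) => E k mk; rewrite (val_add c mk) !(val_cls mk).
- rewrite -(IH ht) -(morph_opp hm); congr h.
  by apply: (@pext G M) => E k mk; rewrite (val_opp mk) !(val_cls mk).
- have vx : valid M x by move=> E k mk; case: (ht E k mk).
  have va : valid M a by move=> E k mk; case: (ht E k mk).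
  have c : ptgt (cls vx) = psrc (cls va).
    apply: (@pext G M) => E k mk.
    by rewrite (val_tgt mk) (val_src mk) !(val_cls mk); case: (ht E k mk).
  rewrite -(IHx vx) -(IHa va) -(morph_act hm c); congr h.
  by apply: (@pext G M) => E k mk; rewrite (val_act c mk) !(val_cls mk).
- rewrite -(IH ht) -(morph_delta hm); congr h.
  by apply: (@pext G M) => E k mk; rewrite (val_delta mk) !(val_cls mk).
Qed.

Theorem pres_univ (D : xcomplex) (f : forall n, G n -> D n) : M f ->
  exists2 h : morph (pres M) D, (forall n (g : G n), h n (pgen g) = f n g) &
    forall h' : morph (pres M) D, (forall n (g : G n), h' n (pgen g) = f n g) ->
      forall n (x : pres M n), h' n x = h n x.
Proof.
move=> m; exists (Morph (val_morph m)) => [n g|h' hg n x] /=.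
  exact: val_gen.
by rewrite -{1}(clsK x) (morph_cls m (morphP h') hg).
Qed.

End UniversalProperty.

(* [e false n x], [e true n x] and [i n x] are 0 (x) x, 1 (x) x and iota (x) x
   for x of dimension n. *)
Record cyl_rel (C D : xcomplex) (e : bool -> forall n, C n -> D n)
    (i : forall n, C n -> D n.+1) : Prop := CylRel {
  cyl_end_morph : forall b, is_morph (e b);
  cyl_tgt : forall n (x : C n), tgt (i n x) = e true 0 (tgt x);
  cyl_src : forall x : C 0, src (i 0 x) = e false 0 x;
  cyl_add1 : forall x y : C 1, tgt x = src y ->
    (i 1 (x + y) = i 1 x ^ e true 1 y + i 1 y)%xc;
  cyl_add : forall n (x y : C n.+2), tgt x = src y ->
    (i n.+2 (x + y) = i n.+2 x + i n.+2 y)%xc;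
  cyl_act : forall n (x : C n.+2) (c : C 1), tgt x = src c ->
    (i n.+2 (x ^ c) = i n.+2 x ^ e true 1 c)%xc;
  cyl_delta1 : forall x : C 1,
    (delta (i 1 x) =
       - e true 1 x - i 0 (src x) + e false 1 x + i 0 (tgt x))%xc;
  cyl_delta : forall n (x : C n.+2),
    (delta (i n.+2 x) =
       - i n.+1 (delta x) - e true n.+2 x + e false n.+2 x ^ i 0 (tgt x))%xc }.

Inductive cyl_gen (C : xcomplex) : nat -> Type :=
| CylEnd (b : bool) n of C n : cyl_gen C n
| CylIota n of C n : cyl_gen C n.+1.

Definition cyl_model (C D : xcomplex) (f : forall n, cyl_gen C n -> D n) :
    Prop :=
  cyl_rel (fun b n (x : C n) => f n (CylEnd b x))
          (fun n (x : C n) => f n.+1 (CylIota x)).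

Definition cylinder (C : xcomplex) : xcomplex := pres (@cyl_model C).

Definition cyl_end (C : xcomplex) (b : bool) n (x : C n) : cylinder C n :=
  pgen _ (CylEnd b x).
Definition cyl_iota (C : xcomplex) n (x : C n) : cylinder C n.+1 :=
  pgen _ (CylIota x).

Definition push_rel (A B D : xcomplex) (f : morph A B) (g : morph A D)
    (E : xcomplex) (h : forall n, B n -> E n) (k : forall n, D n -> E n) :
    Prop :=
  [/\ is_morph h, is_morph k & forall n (a : A n), h n (f n a) = k n (g n a)].

Definition push_model (A B D : xcomplex) (f : morph A B) (g : morph A D)
    (E : xcomplex) (q : forall n, (B n + D n)%type -> E n) : Prop :=
  push_rel f g (fun n b => q n (inl b)) (fun n d => q n (inr d)).

Definition pushout (A B D : xcomplex) (f : morph A B) (g : morph A D) :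
    xcomplex :=
  pres (@push_model A B D f g).

Definition push_inl (A B D : xcomplex) (f : morph A B) (g : morph A D) n
  (b : B n) : pushout f g n := pgen _ (inl b).
Definition push_inr (A B D : xcomplex) (f : morph A B) (g : morph A D) n
  (d : D n) : pushout f g n := pgen _ (inr d).

Lemma cyl_end_morphP (C : xcomplex) b : is_morph (@cyl_end C b).
Proof.
have S n (x : C n) : cyl_end b (src x) = src (cyl_end b x).
  apply: pext => D f m; have v := morph_src (val_morph m); rewrite v !val_gen //.
  exact: (morph_src (cyl_end_morph m b)).
have T n (x : C n) : cyl_end b (tgt x) = tgt (cyl_end b x).
  apply: pext => D f m; have v := morph_tgt (val_morph m); rewrite v !val_gen //.
  exact: (morph_tgt (cyl_end_morph m b)).
split=> //.
- move=> n p; apply: pext => D f m.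
  have v := morph_zero (val_morph m); rewrite v !val_gen //.
  exact: (morph_zero (cyl_end_morph m b)).
- move=> n x y c; apply: pext => D f m.
  have v := morph_add (val_morph m); rewrite v -?T ?c ?S // !val_gen //.
  exact: (morph_add (cyl_end_morph m b)).
- move=> n x; apply: pext => D f m.
  have v := morph_opp (val_morph m); rewrite v !val_gen //.
  exact: (morph_opp (cyl_end_morph m b)).
- move=> n x a c; apply: pext => D f m.
  have v := morph_act (val_morph m); rewrite v -?T ?c ?S // !val_gen //.
  exact: (morph_act (cyl_end_morph m b)).
- move=> n x; apply: pext => D f m.
  have v := morph_delta (val_morph m); rewrite v !val_gen //.
  exact: (morph_delta (cyl_end_morph m b)).
Qed.

Lemma cylinder_rel (C : xcomplex) : cyl_rel (@cyl_end C) (@cyl_iota C).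
Proof.
have T n (x : C n) : tgt (cyl_iota x) = cyl_end true (tgt x).
  apply: pext => D f m; have v := morph_tgt (val_morph m).
  by rewrite v !val_gen //; apply: (cyl_tgt m).
have S0 (x : C 0) : src (cyl_iota x) = cyl_end false x.
  apply: pext => D f m; have v := morph_src (val_morph m).
  by rewrite v !val_gen //; apply: (cyl_src m).
have S n (x : C n.+1) : src (cyl_iota x) = cyl_end true (tgt x).
  by rewrite src_loop T.
have eS b n (x : C n) : src (cyl_end b x) = cyl_end b (src x).
  by rewrite (morph_src (cyl_end_morphP C b)).
have eT b n (x : C n) : tgt (cyl_end b x) = cyl_end b (tgt x).
  by rewrite (morph_tgt (cyl_end_morphP C b)).
split=> //; first exact: cyl_end_morphP.
- move=> x y c; apply: pext => D f m; have hm := val_morph m.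
  have c1 : tgt (cyl_iota x) = src (cyl_end true y) by rewrite T eS c.
  rewrite (morph_add hm) ?tgt_act ?S ?eT // (morph_act hm) // !val_gen //.
  exact: (cyl_add1 m).
- move=> n x y c; apply: pext => D f m; have hm := val_morph m.
  rewrite (morph_add hm) ?T ?S ?c ?src_loop // !val_gen //.
  exact: (cyl_add m).
- move=> n x a c; apply: pext => D f m; have hm := val_morph m.
  rewrite (morph_act hm) ?T ?eS ?c // !val_gen //.
  exact: (cyl_act m).
- move=> x; apply: pext => D f m; have hm := val_morph m.
  have c1 : tgt (- cyl_end true x)%xc = src (- cyl_iota (src x))%xc.
    by rewrite tgt_opp src_opp eS T tgt_obj.
  have c2 : tgt (- cyl_end true x - cyl_iota (src x))%xc = src (cyl_end false x).
    by rewrite tgt_add // tgt_opp S0 eS.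
  have c3 : tgt (- cyl_end true x - cyl_iota (src x) + cyl_end false x)%xc
      = src (cyl_iota (tgt x)) by rewrite tgt_add // eT S0.
  rewrite (morph_delta hm) !(morph_add hm) // !(morph_opp hm) !val_gen //.
  exact: (cyl_delta1 m).
- move=> n x; apply: pext => D f m; have hm := val_morph m.
  have c1 : tgt (- cyl_iota (delta x))%xc = src (- cyl_end true x)%xc.
    by rewrite tgt_opp src_opp S eT tgt_delta.
  have c3 : tgt (cyl_end false x) = src (cyl_iota (tgt x)) by rewrite eT S0.
  have c2 : tgt (- cyl_iota (delta x) - cyl_end true x)%xc
      = src (cyl_end false x ^ cyl_iota (tgt x))%xc.
    by rewrite tgt_add // tgt_opp [RHS]src_loop tgt_act // eS src_loop T tgt_obj.
  rewrite (morph_delta hm) !(morph_add hm) // !(morph_opp hm) (morph_act hm) //.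
  rewrite !val_gen //; exact: (cyl_delta m).
Qed.

Theorem cylinder_univ (C D : xcomplex) (e : bool -> forall n, C n -> D n)
    (i : forall n, C n -> D n.+1) : cyl_rel e i ->
  exists2 h : morph (cylinder C) D,
    (forall b n (x : C n), h n (cyl_end b x) = e b n x) /\
    (forall n (x : C n), h n.+1 (cyl_iota x) = i n x) &
    forall h' : morph (cylinder C) D,
      (forall b n (x : C n), h' n (cyl_end b x) = e b n x) ->
      (forall n (x : C n), h' n.+1 (cyl_iota x) = i n x) ->
      forall n (x : cylinder C n), h' n x = h n x.
Proof.
move=> m.
pose f n (g : cyl_gen C n) : D n :=
  match g in cyl_gen _ n return D n with
  | CylEnd b n x => e b n x
  | CylIota n x => i n x
  end.
have [h hg hu] := @pres_univ _ (@cyl_model C) D f m.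
exists h; first by split=> *; apply: hg.
move=> h' he hi; apply: hu => n [b k x|k x]; [exact: he | exact: hi].
Qed.

Section Pushout.

Variables (A B D : xcomplex) (f : morph A B) (g : morph A D).

Lemma push_gen_morph (C : xcomplex) (F : forall n, C n -> (B n + D n)%type) :
  (forall (E : xcomplex) (q : forall n, (B n + D n)%type -> E n),
    push_model f g q -> is_morph (fun n x => q n (F n x))) ->
  @is_morph C (pushout f g) (fun n x => pgen _ (F n x)).
Proof.
move=> hF.
have S n (x : C n) :
    pgen _ (F 0 (src x)) = src (pgen _ (F n x) : pushout f g n).
  apply: pext => E q m; rewrite (morph_src (val_morph m)) !val_gen //.
  exact: (morph_src (hF E q m)).
have T n (x : C n) :
    pgen _ (F 0 (tgt x)) = tgt (pgen _ (F n x) : pushout f g n).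
  apply: pext => E q m; rewrite (morph_tgt (val_morph m)) !val_gen //.
  exact: (morph_tgt (hF E q m)).
split=> //.
- move=> n p; apply: pext => E q m; rewrite (morph_zero (val_morph m)) !val_gen //.
  exact: (morph_zero (hF E q m)).
- move=> n x y c; apply: pext => E q m.
  rewrite (morph_add (val_morph m)) -?T ?c ?S // !val_gen //.
  exact: (morph_add (hF E q m)).
- move=> n x; apply: pext => E q m; rewrite (morph_opp (val_morph m)) !val_gen //.
  exact: (morph_opp (hF E q m)).
- move=> n x a c; apply: pext => E q m.
  rewrite (morph_act (val_morph m)) -?T ?c ?S // !val_gen //.
  exact: (morph_act (hF E q m)).
- move=> n x; apply: pext => E q m; rewrite (morph_delta (val_morph m)) !val_gen //.
  exact: (morph_delta (hF E q m)).
Qed.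

Lemma pushout_rel : push_rel f g (@push_inl _ _ _ f g) (@push_inr _ _ _ f g).
Proof.
split.
- by apply: push_gen_morph => E q [].
- by apply: push_gen_morph => E q [].
- move=> n a; apply: pext => E q m; rewrite !val_gen //.
  by case: m.
Qed.

Theorem pushout_univ (E : xcomplex) (h : morph B E) (k : morph D E) :
  (forall n (a : A n), h n (f n a) = k n (g n a)) ->
  exists2 r : morph (pushout f g) E,
    (forall n (b : B n), r n (push_inl f g b) = h n b) /\
    (forall n (d : D n), r n (push_inr f g d) = k n d) &
    forall r' : morph (pushout f g) E,
      (forall n (b : B n), r' n (push_inl f g b) = h n b) ->
      (forall n (d : D n), r' n (push_inr f g d) = k n d) ->
      forall n (x : pushout f g n), r' n x = r n x.
Proof.
move=> e.
pose q n (z : (B n + D n)%type) : E n :=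
  match z with inl b => h n b | inr d => k n d end.
have m : push_rel f g (fun n b => q n (inl b)) (fun n d => q n (inr d)).
  by split=> //; apply: morphP.
have [r rg ru] := @pres_univ _ (@push_model _ _ _ f g) E q m.
exists r; first by split=> *; apply: rg.
move=> r' rh rk; apply: ru => n [b|d]; [exact: rh | exact: rk].
Qed.

End Pushout.

Definition point : xcomplex.
Proof.
by refine (@XComplex (fun _ => unit) (fun _ _ => tt) (fun _ _ => tt)
  (fun _ _ => tt) (fun _ _ _ => tt) (fun _ _ => tt) (fun _ _ _ => tt)
  (fun _ _ => tt) _ _ _ _ _ _ _ _ _ _ _ _ _ _ _ _ _ _ _ _ _ _ _ _ _ _ _)
  => * //; repeat match goal with x : unit |- _ => case: x end.
Defined.

Lemma to_point_morphP (C : xcomplex) :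
  @is_morph C point (fun _ _ => tt).
Proof. by []. Qed.

Definition to_point (C : xcomplex) : morph C point :=
  Morph (to_point_morphP C).

(* {1} (x) C is represented by C itself, with its map x |-> 1 (x) x to the
   cylinder. *)
Definition cone (C : xcomplex) : xcomplex :=
  pushout (Morph (cyl_end_morphP C true)) (to_point C).

Section Cone.
Variable C : xcomplex.

(* 0 (x) x, iota (x) x and v in the cone *)
Definition cone_base n (x : C n) : cone C n := push_inl _ _ (cyl_end false x).
Definition cone_iota n (x : C n) : cone C n.+1 := push_inl _ _ (cyl_iota x).
Definition cone_vertex : cone C 0 := push_inr _ _ (tt : point 0).

End Cone.

Fixpoint aDelta (n : nat) : xcomplex :=
  if n is m.+1 then cone (aDelta m) else point.

(* v_i; used only for i <= n *)
Fixpoint vtx (n i : nat) : aDelta n 0 :=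
  match n return aDelta n 0 with
  | 0 => tt
  | m.+1 => if i == m.+1 then cone_vertex (aDelta m) else cone_base (vtx m i)
  end.

(* For n = 1 this is iota (x) v, which is the arrow iota of
   I = Cone(aDelta 0), from 0 = 0 (x) v to 1 = the vertex of the cone. *)
Fixpoint sigma (n : nat) : aDelta n n :=
  match n return aDelta n n with
  | 0 => tt
  | m.+1 => cone_iota (sigma m)
  end.

(* [face n i] is the i-th face of sigma^n, used only for n >= 1 and i <= n. *)
Fixpoint face (n i : nat) : aDelta n n.-1 :=
  match n return aDelta n n.-1 with
  | 0 => tt
  | m.+1 =>
    match m return aDelta m m.-1 -> aDelta m.+1 m with
    | 0 => fun _ => if i == 0 then vtx 1 1 else vtx 1 0
    | k.+1 => fun d =>
        if i < k.+2 then cone_iota d else cone_base (sigma k.+1)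
    end (face m i)
  end.

(* u_n, used only for n >= 1 *)
Definition uarrow (n : nat) : aDelta n 1 :=
  match n return aDelta n 1 with
  | 0 => tt
  | m.+1 => cone_iota (vtx m m)
  end.

(* (-1)^k x *)
Definition signed (C : xcomplex) (n k : nat) (x : C n.+1) : C n.+1 :=
  if odd k then opp x else x.

(* The remaining lemmas show that the faces of sigma^n are composable as in the
   homotopy addition formulae, so that no value of [add] or [act] outside the
   domain of composition occurs there. *)
Section ConeBoundary.
Variable C : xcomplex.
Let pushC := pushout_rel (Morph (cyl_end_morphP C true)) (to_point C).

Lemma tgt_cone_iota n (x : C n) : tgt (cone_iota x) = cone_vertex C.
Proof.
have [H _ e] := pushC.
rewrite /cone_iota -(morph_tgt H) (cyl_tgt (cylinder_rel C)).
exact: (e 0 (tgt x)).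
Qed.

Lemma src_cone_iota0 (x : C 0) : src (cone_iota x) = cone_base x.
Proof.
have [H _ _] := pushC.
by rewrite /cone_iota -(morph_src H) (cyl_src (cylinder_rel C)).
Qed.

Lemma src_cone_base n (x : C n) : src (cone_base x) = cone_base (src x).
Proof.
have [H _ _] := pushC.
by rewrite /cone_base (morph_src (cyl_end_morphP C false)) (morph_src H).
Qed.

Lemma tgt_cone_base n (x : C n) : tgt (cone_base x) = cone_base (tgt x).
Proof.
have [H _ _] := pushC.
by rewrite /cone_base (morph_tgt (cyl_end_morphP C false)) (morph_tgt H).
Qed.
End ConeBoundary.

Lemma vtx_last n : vtx n.+1 n.+1 = cone_vertex (aDelta n).
Proof. by rewrite /= eqxx. Qed.

Lemma tgt_sigma n : tgt (sigma n) = vtx n n.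
Proof. by case: n => [//|n]; rewrite vtx_last; apply: tgt_cone_iota. Qed.

Lemma src_sigma1 : src (sigma 1) = vtx 1 0.
Proof. exact: src_cone_iota0. Qed.

Lemma face_last n : face n.+2 n.+2 = cone_base (sigma n.+1).
Proof. by rewrite /= ltnn. Qed.

Lemma src_face2 :
  [/\ src (face 2 0) = vtx 2 1, src (face 2 1) = vtx 2 0 &
      src (face 2 2) = vtx 2 0].
Proof.
split; try exact: src_cone_iota0.
by apply: (etrans (src_cone_base (sigma 1))); rewrite src_sigma1.
Qed.

Lemma tgt_face2 : tgt (face 2 2) = vtx 2 1.
Proof. by apply: (etrans (tgt_cone_base (sigma 1))); rewrite tgt_sigma. Qed.

Lemma tgt_face n i : i < n.+2 -> tgt (face n.+2 i) = vtx n.+2 n.+2.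
Proof. by move=> h; rewrite vtx_last /= h; apply: tgt_cone_iota. Qed.

Lemma src_uarrow n : src (uarrow n.+2) = tgt (face n.+2 n.+2).
Proof.
rewrite face_last; apply: (etrans (src_cone_iota0 _)).
by rewrite -tgt_sigma; symmetry; apply: tgt_cone_base.
Qed.

Lemma tgt_uarrow n : tgt (uarrow n.+1) = vtx n.+1 n.+1.
Proof. by rewrite vtx_last; apply: tgt_cone_iota. Qed.

(* Main.v *)
Require Import Defs.
From mathcomp Require Import all_boot.

(* In the cone, 1 (x) x collapses to an identity at the vertex v, so x |->
   iota (x) x becomes additive and invariant under the action, and the boundary
   of iota (x) x is - iota (x) delta x + (0 (x) x)^u.  Since sigma^(n+1) =
   iota (x) sigma^n, the formulae follow by induction on n.  In dimension 3 the
   terms sit in a nonabelian group; they may be permuted cyclically because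
   delta delta = 0 and the kernel of delta_2 is central by the Peiffer law. *)

Set Implicit Arguments.
Unset Strict Implicit.
Unset Printing Implicit Defensive.

Local Open Scope xc_scope.

(** * Group laws in a crossed complex *)

Section CrossedComplex.
Variable C : xcomplex.

Lemma add_cancel_l n (x y z : C n.+1) : tgt x = src y -> tgt x = src z ->
  x + y = x + z -> y = z.
Proof.
move=> xy xz e.
have K (w : C n.+1) : tgt x = src w -> - x + (x + w) = w.
  by move=> xw; rewrite add_assoc ?tgt_opp // add_opp_l xw add_zero_l.
by rewrite -(K y) // -(K z) // e.
Qed.

Lemma add_idem n (x : C n.+1) : tgt x = src x -> x + x = x ->
  x = zero (tgt x).
Proof.
move=> l e; apply: (@add_cancel_l _ x) => //; first by rewrite src_zero.
by rewrite add_zero_r.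
Qed.

Lemma opp_unique n (x y : C n.+1) : tgt x = src y -> x + y = zero (src x) ->
  y = - x.
Proof.
move=> c e; apply: (@add_cancel_l _ x) => //; first by rewrite src_opp.
by rewrite add_opp_r.
Qed.

Lemma oppK n (x : C n.+1) : - - x = x.
Proof.
by symmetry; apply: opp_unique; rewrite ?tgt_opp // add_opp_l src_opp.
Qed.

Lemma opp_add n (x y : C n.+1) : tgt x = src y -> - (x + y) = - y - x.
Proof.
move=> c; have c' : tgt (- y) = src (- x) by rewrite tgt_opp src_opp.
symmetry; apply: opp_unique; first by rewrite tgt_add // src_add // src_opp.
rewrite add_assoc //; last by rewrite tgt_add // src_opp.
rewrite -(@add_assoc _ _ x) ?src_opp //.
by rewrite add_opp_r -c add_zero_r add_opp_r src_add.
Qed.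

Lemma opp_zero n (p : C 0) : - zero p = zero p :> C n.+1.
Proof.
symmetry; apply: opp_unique; rewrite ?tgt_zero ?src_zero //.
by rewrite -{1}(src_zero n p) add_zero_l.
Qed.

(** The Peiffer law gives [- w + x + w = x ^ delta w], and here [delta w] is an identity arrow,
    which acts trivially. *)
Lemma ker_delta_central (x w : C 2) : tgt x = src w ->
  delta w = zero (tgt w) -> x + w = w + x.
Proof.
move=> c e; have d : tgt w = src x by rewrite -src_loop -c src_loop.
have := peiffer c; rewrite e d src_loop act_zero => P.
have h : tgt (- w) = src x by rewrite tgt_opp -c src_loop.
rewrite -[X in _ = w + X]P (@add_assoc _ _ w) ?tgt_add ?src_add ?src_opp //.
by rewrite (@add_assoc _ _ w) ?src_opp // add_opp_r src_loop d add_zero_l.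
Qed.

(** The sum [x + y] is central, so [x + (x + y) = (x + y) + x]; cancel [x] on the left. *)
Lemma add_swap (x y : C 2) : tgt x = src y ->
  delta (x + y) = zero (tgt y) -> x + y = y + x.
Proof.
move=> c e; have d : src x = tgt y by rewrite -(src_loop y) -c src_loop.
have c' : tgt y = src x by [].
have l : tgt x = src x by rewrite -src_loop.
apply: (@add_cancel_l _ x); rewrite ?src_add //.
rewrite (@ker_delta_central x (x + y)) ?src_add ?tgt_add //.
by rewrite [RHS]add_assoc.
Qed.

(** Sorts the terms of the three-dimensional formula by face index, once [cone_iota] has carried
    them into an abelian group. *)
Lemma add_perm4 n (p : C 0) (a b c d : C n.+3) :
  tgt a = p -> tgt b = p -> tgt c = p -> tgt d = p ->
  d + a + c + b = a + b + c + d.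
Proof.
move=> ta tb tc td.
have k (x y : C n.+3) : tgt x = p -> tgt y = p -> tgt x = src y.
  by move=> tx ty; rewrite src_loop tx.
have t (x y : C n.+3) : tgt x = p -> tgt y = p -> tgt (x + y) = p.
  by move=> tx ty; rewrite tgt_add //; apply: k.
rewrite [RHS]add_comm; last by apply: k; rewrite ?t.
rewrite -(@add_assoc _ _ a) ?(@add_comm _ _ b) ?add_assoc //.
all: by apply: k; rewrite ?t.
Qed.

(** * Finite sums and signs in the groups over one vertex *)

Section Sum.
Variables (p : C 0) (n : nat).
Implicit Types F : nat -> C n.+2.

Lemma sum_recl k F : \big[add/zero p]_(i < k.+1) F i =
  F 0 + \big[add/zero p]_(i < k) F i.+1.
Proof. by rewrite big_ord_recl. Qed.

Lemma tgt_sum k F : (forall i, i < k -> tgt (F i) = p) ->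
  tgt (\big[add/zero p]_(i < k) F i) = p.
Proof.
elim: k F => [|k IH] F h; first by rewrite big_ord0 tgt_zero.
have IHk := IH (fun i => F i.+1) (fun i => h i.+1).
by rewrite sum_recl tgt_add // src_loop IHk h.
Qed.

(** The iterated sum is nested to the right and [add] is associative only on composable cells, so
    splitting off the last term requires all terms to lie over [p]. *)
Lemma sum_recr k F : (forall i, i <= k -> tgt (F i) = p) ->
  \big[add/zero p]_(i < k.+1) F i = \big[add/zero p]_(i < k) F i + F k.
Proof.
elim: k F => [|k IH] F h.
  by rewrite sum_recl !big_ord0 -{1}(h 0) // add_zero_r -(h 0) // -src_loop
    add_zero_l.
have T : tgt (\big[add/zero p]_(i < k) F i.+1) = p.
  by apply: (@tgt_sum k (fun i => F i.+1)) => i /ltnW; apply: (h i.+1).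
rewrite sum_recl (IH (fun i => F i.+1)); last by move=> i; apply: (h i.+1).
by rewrite (sum_recl k) add_assoc // src_loop ?T h.
Qed.

End Sum.

(** Negation reverses the order of the terms; commutativity in dimension at least 3 restores it. *)
Lemma opp_sum p n k (F : nat -> C n.+3) : (forall i, i < k -> tgt (F i) = p) ->
  - (\big[add/zero p]_(i < k) F i) = \big[add/zero p]_(i < k) - F i.
Proof.
elim: k F => [|k IH] F h; first by rewrite !big_ord0 opp_zero.
have h' i : i < k -> tgt (F i.+1) = p by apply: (h i.+1).
have T := tgt_sum h'.
have c : tgt (F 0) = src (\big[add/zero p]_(i < k) F i.+1).
  by rewrite src_loop T h.
rewrite sum_recl opp_add // add_comm; last by rewrite tgt_opp src_opp c.
by rewrite (sum_recl p k (fun i => - F i)) -(IH (fun i => F i.+1)).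
Qed.

Lemma tgt_signed n k (x : C n.+2) : tgt (signed k x) = tgt x.
Proof. by rewrite /signed; case: odd; rewrite ?tgt_opp ?src_loop. Qed.

Lemma opp_signed n k (x : C n.+1) : - signed k x = signed k.+1 x.
Proof. by rewrite /signed /=; case: odd; rewrite ?oppK. Qed.

End CrossedComplex.

(** * The map [cone_iota] and its boundary formulae *)

Section Cone.
Variable C : xcomplex.
Local Notation v := (cone_vertex C).
Let pushC := pushout_rel (Morph (cyl_end_morphP C true)) (to_point C).

(** The pushout square sends [1 (x) x] through [point], whose only cell in a positive dimension is
    an identity. *)
Lemma push_end_true n (x : C n.+1) :
  push_inl _ _ (cyl_end true x) = zero v :> cone C n.+1.
Proof.
have [_ K e] := pushC.
by rewrite /cone_vertex -(morph_zero K); apply: (e n.+1 x).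
Qed.

Lemma src_cone_iota n (x : C n.+1) : src (cone_iota x) = v.
Proof. by rewrite src_loop tgt_cone_iota. Qed.

Lemma cone_iota_add n (x y : C n.+1) : tgt x = src y ->
  cone_iota (x + y) = cone_iota x + cone_iota y.
Proof.
have [H _ _] := pushC; have R := cylinder_rel C.
have T k (z : C k) : tgt (cyl_iota z) = cyl_end true (tgt z).
  exact: (cyl_tgt R).
have eS k (z : C k) : src (cyl_end true z) = cyl_end true (src z).
  by rewrite (morph_src (cyl_end_morphP C true)).
have eT k (z : C k) : tgt (cyl_end true z) = cyl_end true (tgt z).
  by rewrite (morph_tgt (cyl_end_morphP C true)).
(* Only dimension 1 has the twisted rule for [iota (x) (x + y)]; its exponent [1 (x) y] becomes an
   identity arrow at the vertex. *)
case: n x y => [|n] x y c; rewrite /cone_iota.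
  rewrite (cyl_add1 R) //.
  have c' : tgt (cyl_iota x) = src (cyl_end true y) by rewrite T eS c.
  rewrite (morph_add H); last by rewrite tgt_act // src_loop T eT.
  rewrite (morph_act H) //.
  by rewrite push_end_true -(tgt_cone_iota x) act_zero.
by rewrite (cyl_add R) // (morph_add H) // src_loop !T c src_loop.
Qed.

(** In the cylinder the exponent is [1 (x) a], which collapses to an identity arrow. *)
Lemma cone_iota_act n (x : C n.+2) (a : C 1) : tgt x = src a ->
  cone_iota (x ^ a) = cone_iota x.
Proof.
have [H _ _] := pushC; have R := cylinder_rel C => c.
rewrite /cone_iota (cyl_act R) // (morph_act H).
  by rewrite push_end_true -(tgt_cone_iota x) act_zero.
by rewrite (cyl_tgt R) -(morph_src (cyl_end_morphP C true)) c.
Qed.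

(** By additivity the image of an identity is idempotent, hence an identity. *)
Lemma cone_iota_zero n (p : C 0) : cone_iota (zero p : C n.+1) = zero v.
Proof.
rewrite -(tgt_cone_iota (zero p : C n.+1)); apply: add_idem.
  by rewrite -src_loop.
by rewrite -cone_iota_add ?tgt_zero ?src_zero // -{1}(src_zero n p) add_zero_l.
Qed.

Lemma cone_iota_opp n (x : C n.+1) : cone_iota (- x) = - cone_iota x.
Proof.
apply: opp_unique; first by rewrite tgt_cone_iota src_cone_iota.
by rewrite -cone_iota_add ?src_opp // add_opp_r cone_iota_zero src_cone_iota.
Qed.

Lemma cone_iota_signed n k (x : C n.+1) :
  cone_iota (signed k x) = signed k (cone_iota x).
Proof. by rewrite /signed; case: odd; rewrite ?cone_iota_opp. Qed.

Lemma cone_iota_sum n k p (F : nat -> C n.+2) :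
  (forall i, i < k -> tgt (F i) = p) ->
  cone_iota (\big[add/zero p]_(i < k) F i) =
    \big[add/zero v]_(i < k) cone_iota (F i).
Proof.
elim: k F => [|k IH] F h; first by rewrite !big_ord0 cone_iota_zero.
have h' i : i < k -> tgt (F i.+1) = p by apply: (h i.+1).
rewrite sum_recl cone_iota_add; last by rewrite src_loop (tgt_sum h') h.
by rewrite (sum_recl v k (fun i => cone_iota (F i))) (IH (fun i => F i.+1)).
Qed.

Lemma delta_cone_iota1 (x : C 1) : delta (cone_iota x) =
  - cone_iota (src x) + cone_base x + cone_iota (tgt x).
Proof.
have [H _ _] := pushC; have R := cylinder_rel C.
have E : is_morph (@cyl_end C true) := cyl_end_morphP C true.
have E' : is_morph (@cyl_end C false) := cyl_end_morphP C false.
(* [c1] to [c3] make the terms of the cylinder relation composable, so that the map to the cone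
   distributes over them. *)
have c1 : tgt (- cyl_end true x) = src (- cyl_iota (src x)).
  by rewrite tgt_opp src_opp -(morph_src E) (cyl_tgt R) tgt_obj.
have c2 : tgt (- cyl_end true x - cyl_iota (src x)) = src (cyl_end false x).
  by rewrite tgt_add // tgt_opp (cyl_src R) -(morph_src E').
have c3 : tgt (- cyl_end true x - cyl_iota (src x) + cyl_end false x) =
    src (cyl_iota (tgt x)).
  by rewrite tgt_add // -(morph_tgt E') (cyl_src R).
rewrite /cone_iota -(morph_delta H) (cyl_delta1 R) !(morph_add H) //.
rewrite !(morph_opp H) push_end_true opp_zero.
rewrite -/(cone_iota (src x)) -/(cone_iota (tgt x)) -/(cone_base x).
congr (_ + _ + _).
by rewrite -(tgt_cone_iota (src x)) -src_opp add_zero_l.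
Qed.

Lemma delta_cone_iota n (x : C n.+2) : delta (cone_iota x) =
  - cone_iota (delta x) + cone_base x ^ cone_iota (tgt x).
Proof.
have [H _ _] := pushC; have R := cylinder_rel C.
have E : is_morph (@cyl_end C true) := cyl_end_morphP C true.
have E' : is_morph (@cyl_end C false) := cyl_end_morphP C false.
have c1 : tgt (- cyl_iota (delta x)) = src (- cyl_end true x).
  by rewrite tgt_opp src_opp src_loop (cyl_tgt R) -(morph_tgt E) tgt_delta.
have c2 : tgt (cyl_end false x) = src (cyl_iota (tgt x)).
  by rewrite -(morph_tgt E') (cyl_src R).
have c3 : tgt (- cyl_iota (delta x) - cyl_end true x) =
    src (cyl_end false x ^ cyl_iota (tgt x)).
  rewrite tgt_add // tgt_opp [RHS]src_loop tgt_act // (cyl_tgt R) tgt_obj.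
  by rewrite -(morph_src E) src_loop.
rewrite /cone_iota -(morph_delta H) (cyl_delta R) !(morph_add H) //.
rewrite !(morph_opp H) (morph_act H) // push_end_true opp_zero.
rewrite -/(cone_iota (tgt x)) -/(cone_iota (delta x)) -/(cone_base x).
congr (_ + _).
by rewrite -(src_cone_iota (delta x)) -tgt_opp add_zero_r.
Qed.

End Cone.

(** * The recursion for the boundary, and dimensions 2 and 3 *)

Lemma face_lt n i : i < n.+2 -> face n.+2 i = cone_iota (face n.+1 i).
Proof. by move=> h /=; rewrite h. Qed.

(** The target of [sigma n.+2] is its last vertex, so the acting arrow [iota (x) tgt] is
    [uarrow n.+3]. *)
Lemma delta_sigma n : delta (sigma n.+3) =
  - cone_iota (delta (sigma n.+2)) + face n.+3 n.+3 ^ uarrow n.+3.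
Proof.
rewrite face_last; apply: (etrans (delta_cone_iota _)).
by rewrite (tgt_sigma n.+2).
Qed.

Lemma tgt_face_act n : tgt (face n.+3 n.+3 ^ uarrow n.+3) = vtx n.+3 n.+3.
Proof. by rewrite tgt_act ?tgt_uarrow // src_uarrow. Qed.

(** One dimension up, the exponent on the last face disappears and that face becomes the last but
    one. *)
Lemma cone_iota_face_act n :
  cone_iota (face n.+3 n.+3 ^ uarrow n.+3) = face n.+4 n.+3.
Proof. by rewrite cone_iota_act ?src_uarrow // -face_lt. Qed.

(** The source of [sigma 1] is its face 1 and the target its face 0, which fixes the order of the
    terms. *)
Lemma delta_sigma2 :
  delta (sigma 2) = - face 2 1 + face 2 2 + face 2 0.
Proof.
rewrite face_last !face_lt //.
by rewrite [LHS]delta_cone_iota1 src_sigma1 (tgt_sigma 1).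
Qed.

Lemma src_face3 i : i < 3 -> src (face 3 i) = vtx 3 3.
Proof. by move=> h; rewrite src_loop tgt_face. Qed.

Lemma delta_sigma3 :
  delta (sigma 3) =
    face 3 3 ^ uarrow 3 - face 3 0 - face 3 2 + face 3 1.
Proof.
have [s0 s1 s2] := src_face2.
have c1 : tgt (- face 2 1) = src (face 2 2) by rewrite tgt_opp s1 s2.
have c2 : tgt (- face 2 1 + face 2 2) = src (face 2 0).
  by rewrite tgt_add // tgt_face2 s0.
set A := _ ^ _.
have tA : tgt A = vtx 3 3 by exact: tgt_face_act.
have tf i : i < 3 -> tgt (face 3 i) = vtx 3 3 by exact: tgt_face.
have sf := src_face3.
have iD : cone_iota (delta (sigma 2)) = - face 3 1 + face 3 2 + face 3 0.
  by rewrite delta_sigma2 !cone_iota_add // cone_iota_opp -!face_lt.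
have tB : tgt (- cone_iota (delta (sigma 2))) = vtx 3 3.
  by rewrite tgt_opp src_cone_iota vtx_last.
have D := delta_sigma 0.
(* The recursion puts [A] last; the whole sum is a boundary, so [delta] kills it and its two parts
   may be exchanged. *)
rewrite D add_swap; first last.
- by rewrite -D delta_delta (tgt_sigma 3) -/A tA.
- by rewrite tB src_loop -/A tA.
(* Negating [- face 3 1 + face 3 2 + face 3 0] reverses it into the stated order. *)
have k1 : tgt (- face 3 1) = src (face 3 2) by rewrite tgt_opp !sf.
rewrite iD opp_add; last by rewrite tgt_add // tf // sf.
rewrite opp_add // oppK.
have k2 : tgt (- face 3 2) = src (face 3 1) by rewrite tgt_opp !sf.
have k3 : tgt (- face 3 0) = src (- face 3 2) by rewrite tgt_opp src_opp sf ?tf.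
have k4 : tgt A = src (- face 3 0) by rewrite tA src_opp tf.
by rewrite -/A !add_assoc ?tgt_add ?src_add.
Qed.

(** * Dimensions at least 4 *)

Lemma tgt_signed_face n m i : i < n.+3 ->
  tgt (signed m (face n.+3 i)) = vtx n.+3 n.+3.
Proof. by move=> h; rewrite tgt_signed tgt_face. Qed.

Lemma cone_iota_delta_sigma3 : cone_iota (delta (sigma 3)) =
  \big[add/zero (vtx 4 4)]_(i < 4) signed (3 - i) (face 4 i).
Proof.
have tf i : i < 4 -> tgt (face 4 i) = vtx 4 4 by exact: tgt_face.
have sf i : i < 4 -> src (face 4 i) = vtx 4 4.
  by move=> h; rewrite src_loop tf.
have tA := tgt_face_act 0.
have sg := src_face3.
have tg i : i < 3 -> tgt (face 3 i) = vtx 3 3 by exact: tgt_face.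
rewrite delta_sigma3 !cone_iota_add ?tgt_add ?tgt_opp ?src_opp ?tg ?sg //.
rewrite !cone_iota_opp cone_iota_face_act -!face_lt //.
rewrite (add_perm4 (p := vtx 4 4)) ?tgt_opp ?sf ?tf //.
pose F i := signed (3 - i) (face 4 i).
have tF i : i < 4 -> tgt (F i) = vtx 4 4 by exact: tgt_signed_face.
rewrite -[RHS]/(\big[add/zero (vtx 4 4)]_(i < 4) F i).
(* Unrolling from the right gives the left-nested bracketing of the other side, preceded by the
   empty sum. *)
rewrite !sum_recr; try by move=> i h; apply/tF/(leq_ltn_trans h).
by rewrite big_ord0 -{1}(tF 0) // -src_loop add_zero_l.
Qed.

Lemma delta_sigma_ge4_of n :
  cone_iota (delta (sigma n.+3)) = \big[add/zero (vtx n.+4 n.+4)]_(i < n.+4)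
    signed (n.+3 - i) (face n.+4 i) ->
  delta (sigma n.+4) = face n.+4 n.+4 ^ uarrow n.+4
    + \big[add/zero (vtx n.+4 n.+4)]_(i < n.+4)
        signed (n.+4 - i) (face n.+4 i).
Proof.
move=> e; rewrite delta_sigma e.
rewrite (@opp_sum _ _ _ _ (fun i => signed (n.+3 - i) (face n.+4 i)));
  last by move=> i h; apply: tgt_signed_face.
(* Since [i <= n.+3], the subtraction is not truncated, and negation raises the exponent of the sign
   by one. *)
under eq_bigr => i _ do rewrite opp_signed -subSn ?leq_ord //.
rewrite add_comm // src_loop (tgt_face_act n.+1).
apply: (tgt_sum (F := fun i => signed (n.+4 - i) (face n.+4 i))) => i h.
exact: tgt_signed_face.
Qed.

(** The induction runs on the image under [cone_iota]: there the action has vanished and the group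
    is abelian, so one formula covers [sigma 3] as well. *)
Lemma cone_iota_delta_sigma n : cone_iota (delta (sigma n.+3)) =
  \big[add/zero (vtx n.+4 n.+4)]_(i < n.+4) signed (n.+3 - i) (face n.+4 i).
Proof.
elim: n => [|n IH]; first exact: cone_iota_delta_sigma3.
pose F i := signed (n.+4 - i) (face n.+4 i).
pose G i := signed (n.+4 - i) (face n.+4.+1 i).
have tF i : i < n.+4 -> tgt (F i) = vtx n.+4 n.+4 by exact: tgt_signed_face.
have tG i : i <= n.+4 -> tgt (G i) = vtx n.+4.+1 n.+4.+1.
  exact: tgt_signed_face.
have tS := tgt_sum tF.
rewrite (delta_sigma_ge4_of IH) cone_iota_add; last first.
  by rewrite (tgt_face_act n.+1) src_loop tS.
rewrite cone_iota_face_act (cone_iota_sum tF) (sum_recr tG) -vtx_last.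
under eq_bigr => i _ do rewrite /F cone_iota_signed -face_lt 1?leqW //.
(* The former last face is now the top term of the sum, with sign exponent 0. *)
rewrite {2}/G subnn add_comm // src_loop (tgt_face (n := n.+3)) //.
by symmetry; apply: (tgt_sum (F := G)) => i h; apply/tG/ltnW.
Qed.

Theorem theorem8p4 :
  [/\ delta (sigma 2) = (- face 2 1 + face 2 2 + face 2 0)%xc,
      delta (sigma 3) =
        ((face 3 3 ^ uarrow 3) - face 3 0 - face 3 2 + face 3 1)%xc &
      forall n : nat,
        delta (sigma n.+4) =
          ((face n.+4 n.+4 ^ uarrow n.+4)
           + \big[add/zero (vtx n.+4 n.+4)]_(i < n.+4)
               signed (n.+4 - i)%N (face n.+4 i))%xc].
Proof.
split; [exact: delta_sigma2 | exact: delta_sigma3 | move=> n].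
exact/delta_sigma_ge4_of/cone_iota_delta_sigma.
Qed.
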